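(* Let the setting and the algorithm RandProx-FL be as in the context, and suppose $0<\gamma<\frac{2}{L}$. For $t\ge0$ let $$\Psi^t:=\sum_{i=1}^n\left(\frac{1}{\gamma}\|x_i^t-x^\star\|^2+\gamma(1+\omega)^2\|u_i^t-u_i^\star\|^2\right),$$ where $x^\star$ is the unique minimizer of $\sum_{i=1}^n f_i$ and $u_i^\star:=-\nabla f_i(x^\star)$. Then for every $t\ge0$, $\mathbb{E}[\Psi^t]\le c^t\Psi^0$, where $$c:=\max\left((1-\gamma\mu)^2,\ (\gamma L-1)^2,\ 1-\frac{1}{(1+\omega)^2}\right)<1.$$ Moreover, every $(x_i^t)_t$ and $(\hat{x}_i^t)_t$ converges to $x^\star$ and every $(u_i^t)_t$ converges to $u_i^\star$, almost surely.
   Context: $d,n\ge1$; each $f_i:\mathbb{R}^d\to\mathbb{R}$, $i=1,\dots,n$, is $\mu$-strongly convex and $L$-smooth ($\nabla f_i$ $L$-Lipschitz), $L\ge\mu>0$. Problem: minimize $\sum_{i=1}^n f_i(x)$ over $x\in\mathbb{R}^d$. Algorithm RandProx-FL: inputs $(x_i^0)_{i=1}^n,(u_i^0)_{i=1}^n\in(\mathbb{R}^d)^n$ with $\sum_i u_i^0=0$, $\gamma>0$, $\omega\ge0$; for $t\ge0$: for each $i$, $\hat{x}_i^t:=x_i^t-\gamma\nabla f_i(x_i^t)-\gamma u_i^t$ and $a_i^t:=\mathcal{R}^t(\hat{x}_i^t)$; $a^t:=\frac1n\sum_i a_i^t$; for each $i$, $d_i^t:=a_i^t-a^t$, $u_i^{t+1}:=u_i^t+\frac{1}{\gamma(1+\omega)^2}d_i^t$,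 $x_i^{t+1}:=\hat{x}_i^t-\frac{1}{1+\omega}d_i^t$. Here, at each iteration $t$, the same random linear operator $\mathcal{R}^t$ on $\mathbb{R}^d$ is applied at every $i$; with $\mathcal{F}_t$ the $\sigma$-algebra generated by the iterates $(x_i^s,u_i^s)_{i}$, $s\le t$, it satisfies $\mathbb{E}[\mathcal{R}^t(y)\mid\mathcal{F}_t]=y$ and $\mathbb{E}[\|\mathcal{R}^t(y)-y\|^2\mid\mathcal{F}_t]\le\omega\|y\|^2$ for every $\mathcal{F}_t$-measurable random vector $y\in\mathbb{R}^d$. *)

(* Defs.v *)
From HB Require Import structures.
From mathcomp Require Import all_boot all_order all_algebra.
From mathcomp Require Import all_classical all_reals all_analysis.
Set Implicit Arguments. Unset Strict Implicit. Unset Printing Implicit Defensive.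
Import Order.TTheory GRing.Theory Num.Theory.
Import numFieldNormedType.Exports.
Local Open Scope classical_set_scope.
Local Open Scope ring_scope.

Definition dotv (R : realType) (d : nat) (x y : 'rV[R]_d) : R :=
  \sum_(j < d) x ord0 j * y ord0 j.
Definition sqn (R : realType) (d : nat) (x : 'rV[R]_d) : R := dotv x x.
Definition enorm (R : realType) (d : nat) (x : 'rV[R]_d) : R := Num.sqrt (sqn x).

Definition strongly_convex_euc (R : realType) (d : nat) (mu : R) (f : 'rV[R]_d -> R) :=
  forall (x y : 'rV[R]_d) (th : R), 0 <= th <= 1 ->
    f (th *: x + (1 - th) *: y) <=
      th * f x + (1 - th) * f y - mu / 2 * th * (1 - th) * sqn (x - y).

Definition is_gradient (R : realType) (d : nat) (f : 'rV[R]_d -> R)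
    (g : 'rV[R]_d -> 'rV[R]_d) :=
  forall x : 'rV[R]_d, differentiable f x /\ forall v, 'd f x v = dotv (g x) v.

Definition lipschitz_euc (R : realType) (d : nat) (L : R) (g : 'rV[R]_d -> 'rV[R]_d) :=
  forall x y, enorm (g x - g y) <= L * enorm (x - y).

(* A state is ((x_i)_i, (u_i)_i).  The random linear operator R^t at a fixed
   sample point is a matrix M, acting on row vectors as y |-> y *m M. *)
Definition rp_state (R : realType) (n d : nat) :=
  (('I_n -> 'rV[R]_d) * ('I_n -> 'rV[R]_d))%type.

Definition rp_xhat (R : realType) (n d : nat) (grad : 'I_n -> 'rV[R]_d -> 'rV[R]_d)
    (gamma : R) (s : rp_state R n d) (i : 'I_n) : 'rV[R]_d :=
  s.1 i - gamma *: grad i (s.1 i) - gamma *: s.2 i.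

Definition rp_step (R : realType) (n d : nat) (grad : 'I_n -> 'rV[R]_d -> 'rV[R]_d)
    (gamma om : R) (M : 'M[R]_d) (s : rp_state R n d) : rp_state R n d :=
  let xh := rp_xhat grad gamma s in
  let a := fun i => xh i *m M in
  let abar := n%:R^-1 *: \sum_(k < n) a k in
  let dd := fun i => a i - abar in
  (fun i => xh i - (1 + om)^-1 *: dd i,
   fun i => s.2 i + (gamma * (1 + om) ^+ 2)^-1 *: dd i).

Fixpoint rp_iter (R : realType) (n d : nat) (grad : 'I_n -> 'rV[R]_d -> 'rV[R]_d)
    (gamma om : R) (Rs : nat -> 'M[R]_d) (s0 : rp_state R n d) (t : nat)
    : rp_state R n d :=
  match t with
  | 0 => s0
  | t'.+1 => rp_step grad gamma om (Rs t') (rp_iter grad gamma om Rs s0 t')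
  end.

Definition rp_filt (R : realType) (n d : nat) (grad : 'I_n -> 'rV[R]_d -> 'rV[R]_d)
    (gamma om : R) (Omega : Type) (Rop : nat -> Omega -> 'M[R]_d)
    (s0 : rp_state R n d) (t : nat) : set (set Omega) :=
  <<s [set A | exists (s : nat) (i : 'I_n) (j : 'I_d) (B : set R),
        (s <= t)%N /\ measurable B /\
        (A = (fun w => (rp_iter grad gamma om (Rop^~ w) s0 s).1 i ord0 j) @^-1` B \/
         A = (fun w => (rp_iter grad gamma om (Rop^~ w) s0 s).2 i ord0 j) @^-1` B)] >>.

Definition meas_wrt (Omega : Type) (R : realType) (G : set (set Omega))
    (h : Omega -> R) := forall B : set R, measurable B -> G (h @^-1` B).

(* E[R^t(y) | F_t] = y and E[||R^t(y) - y||^2 | F_t] <= om ||y||^2 for every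
   F_t-measurable random vector y, written through the defining property of
   conditional expectation (integrals over every event A of F_t). *)
Definition rp_oracle (R : realType) (n d : nat) (grad : 'I_n -> 'rV[R]_d -> 'rV[R]_d)
    (gamma om : R) (dO : measure_display) (Omega : measurableType dO)
    (P : probability Omega R) (Rop : nat -> Omega -> 'M[R]_d)
    (s0 : rp_state R n d) : Prop :=
  forall (t : nat) (y : Omega -> 'rV[R]_d),
    let F := rp_filt grad gamma om Rop s0 t in
    (forall j, meas_wrt F (fun w => y w ord0 j)) ->
    ((forall j, P.-integrable setT (fun w => (y w ord0 j)%:E)) ->
     (forall j, P.-integrable setT (fun w => ((y w *m Rop t w) ord0 j)%:E)) ->
     forall A, F A -> forall j,
       (\int[P]_(w in A) ((y w *m Rop t w) ord0 j)%:E =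
        \int[P]_(w in A) (y w ord0 j)%:E)%E) /\
    (forall A, F A ->
       (\int[P]_(w in A) (sqn (y w *m Rop t w - y w))%:E <=
        \int[P]_(w in A) (om * sqn (y w))%:E)%E).

Definition rp_Psi (R : realType) (n d : nat) (grad : 'I_n -> 'rV[R]_d -> 'rV[R]_d)
    (gamma om : R) (xstar : 'rV[R]_d) (s : rp_state R n d) : R :=
  \sum_(i < n) (gamma^-1 * sqn (s.1 i - xstar)
               + gamma * (1 + om) ^+ 2 * sqn (s.2 i - (- grad i xstar))).

(* Main.v *)
Require Import Defs.
From HB Require Import structures.
From mathcomp Require Import all_boot all_order all_algebra.
From mathcomp Require Import all_classical all_reals all_analysis measurable_realfun.
From mathcomp Require Import ring lra.
Set Implicit Arguments. Unset Strict Implicit. Unset Printing Implicit Defensive.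
Import Order.TTheory GRing.Theory Num.Theory.
Import numFieldNormedType.Exports.
Local Open Scope classical_set_scope.
Local Open Scope ring_scope.

(* Write p_i = xhat_i - x*, b_i = u_i - u_i*, q = 1 + omega, let z_i be xhat_i minus its mean over
   i and d_i = z_i M its image under the random operator. Since sum_i z_i = sum_i b_i = 0, expanding
   Psi after one step gives
     sum_i (1/gamma |p_i + gamma b_i|^2 + gamma (q^2 - 1) |b_i|^2)
     + 2/(gamma q^2) sum_i (|d_i - z_i|^2 - omega |z_i|^2) + sum_i <V_i, d_i - z_i>
   with V_i depending on the past only. The last two sums have nonpositive, resp. zero, expectation,
   and p_i + gamma b_i is the difference of two gradient steps, which contract. The geometric decay
   of E Psi makes sum_t Psi^t integrable, so Psi^t tends to 0 almost surely. *)

(** * Euclidean geometry *)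

(** The step sizes 1/q and 1/(gamma q^2) and the weight gamma q^2 in Psi are tuned together. The
    image d_i enters Psi quadratically with total coefficient 2/(gamma q^2), and E |d_i|^2 <= q E
    |z_i|^2, a cost of at most 2/(gamma q) |z_i|^2 in the mean; the linear term -2/(gamma q) <p_i,
    d_i> repays exactly this after summation, since sum_i <p_i, z_i> = sum_i |z_i|^2. The term in
    <b_i, d_i> completes the square |p_i + gamma b_i|^2 and leaves on |b_i|^2 the weight gamma (q^2
    - 1) = (1 - 1/q^2) gamma q^2, whence the last entry of c. Conditional expectations are used only
    through integrals over the whole space: V_i is absorbed into the random vector given to the
    oracle. The obstacle is integrability: the unbiasedness half of the oracle presupposes it, the
    variance half does not. The iterates are therefore shown square integrable by induction on t,
    the variance half supplying the integrability of the noise. *)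

Lemma dotvC (R : realType) (d : nat) (x y : 'rV[R]_d) : dotv x y = dotv y x.
Proof. by apply: eq_bigr => j _; rewrite mulrC. Qed.

Lemma dotvDl (R : realType) (d : nat) (x y z : 'rV[R]_d) :
  dotv (x + y) z = dotv x z + dotv y z.
Proof. by rewrite -big_split /=; apply: eq_bigr => j _; rewrite mxE mulrDl. Qed.

Lemma dotvZl (R : realType) (d : nat) (a : R) (x y : 'rV[R]_d) :
  dotv (a *: x) y = a * dotv x y.
Proof. by rewrite mulr_sumr; apply: eq_bigr => j _; rewrite mxE mulrA. Qed.

Lemma dotvNl (R : realType) (d : nat) (x y : 'rV[R]_d) : dotv (- x) y = - dotv x y.
Proof. by rewrite -scaleN1r dotvZl mulN1r. Qed.

Lemma dotvBl (R : realType) (d : nat) (x y z : 'rV[R]_d) :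
  dotv (x - y) z = dotv x z - dotv y z.
Proof. by rewrite dotvDl dotvNl. Qed.

Lemma dotvDr (R : realType) (d : nat) (x y z : 'rV[R]_d) :
  dotv z (x + y) = dotv z x + dotv z y.
Proof. by rewrite dotvC dotvDl !(dotvC z). Qed.

Lemma dotvZr (R : realType) (d : nat) (a : R) (x y : 'rV[R]_d) :
  dotv y (a *: x) = a * dotv y x.
Proof. by rewrite dotvC dotvZl dotvC. Qed.

Lemma dotvNr (R : realType) (d : nat) (x y : 'rV[R]_d) : dotv y (- x) = - dotv y x.
Proof. by rewrite dotvC dotvNl dotvC. Qed.

Lemma dotvBr (R : realType) (d : nat) (x y z : 'rV[R]_d) :
  dotv z (x - y) = dotv z x - dotv z y.
Proof. by rewrite dotvDr dotvNr. Qed.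

Lemma dot0v (R : realType) (d : nat) (x : 'rV[R]_d) : dotv 0 x = 0.
Proof. by rewrite -(scale0r x) dotvZl mul0r. Qed.

Definition dotvE := (dotvDl, dotvDr, dotvBl, dotvBr, dotvNl, dotvNr, dotvZl, dotvZr).

Lemma dotv_suml (R : realType) (d : nat) (I : finType) (F : I -> 'rV[R]_d) y :
  dotv (\sum_i F i) y = \sum_i dotv (F i) y.
Proof.
apply: (big_ind2 (fun a b => dotv a y = b)) => //; first exact: dot0v.
by move=> a _ b _ <- <-; rewrite dotvDl.
Qed.

Lemma sqn_ge0 (R : realType) (d : nat) (x : 'rV[R]_d) : 0 <= sqn x.
Proof. by apply: sumr_ge0 => j _; exact: sqr_ge0. Qed.

Lemma sqr_coord_le_sqn (R : realType) (d : nat) (x : 'rV[R]_d) j :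
  x ord0 j ^+ 2 <= sqn x.
Proof.
rewrite /sqn /dotv (bigD1 j) //= expr2 lerDl.
by apply: sumr_ge0 => i _; exact: sqr_ge0.
Qed.

Lemma sqn_eq0 (R : realType) (d : nat) (x : 'rV[R]_d) : sqn x <= 0 -> x = 0.
Proof.
move=> x0; apply/rowP => j; rewrite mxE; apply/eqP.
by rewrite -sqrf_eq0 eq_le sqr_ge0 (le_trans (sqr_coord_le_sqn _ j)).
Qed.

Lemma sqnD (R : realType) (d : nat) (x y : 'rV[R]_d) :
  sqn (x + y) = sqn x + 2 * dotv x y + sqn y.
Proof. by rewrite /sqn !dotvE (dotvC y x); ring. Qed.

Lemma sqnB (R : realType) (d : nat) (x y : 'rV[R]_d) :
  sqn (x - y) = sqn x - 2 * dotv x y + sqn y.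
Proof. by rewrite /sqn !dotvE (dotvC y x); ring. Qed.

Lemma sqnZ (R : realType) (d : nat) (a : R) (x : 'rV[R]_d) :
  sqn (a *: x) = a ^+ 2 * sqn x.
Proof. by rewrite /sqn !dotvE; ring. Qed.

Lemma sqnN (R : realType) (d : nat) (x : 'rV[R]_d) : sqn (- x) = sqn x.
Proof. by rewrite -scaleN1r sqnZ sqrrN expr1n mul1r. Qed.

Lemma sqnB_le (R : realType) (d : nat) (x y : 'rV[R]_d) :
  sqn (x - y) <= 2 * sqn x + 2 * sqn y.
Proof. by have := sqn_ge0 (x + y); rewrite sqnB sqnD; lra. Qed.

(** Cauchy-Schwarz combined with a bound on |x|, obtained without square roots by expanding |x - K
    y|^2 >= 0. It turns Lipschitz bounds on gradients into bounds on inner products. *)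
Lemma dotv_le_sqn (R : realType) (d : nat) (K : R) (x y : 'rV[R]_d) :
  0 < K -> sqn x <= K ^+ 2 * sqn y -> dotv x y <= K * sqn y.
Proof.
move=> K0 xy; have := sqn_ge0 (x - K *: y); rewrite sqnB sqnZ dotvZr => h.
rewrite -(ler_pM2l K0); nra.
Qed.

(** * Smooth strongly convex functions *)

Lemma lipschitz_sqn (R : realType) (d : nat) (L : R) (g : 'rV[R]_d -> 'rV[R]_d) x y :
  lipschitz_euc L g -> sqn (g x - g y) <= L ^+ 2 * sqn (x - y).
Proof.
move=> /(_ x y); rewrite /enorm => h.
rewrite -[leLHS]sqr_sqrtr ?sqn_ge0// -[in leRHS](@sqr_sqrtr _ (sqn (x - y))) ?sqn_ge0//.
by rewrite -exprMn ler_pXn2r// nnegrE ?sqrtr_ge0// (le_trans _ h) ?sqrtr_ge0.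
Qed.

(** After rewriting its argument, the difference quotient along the line is the one that defines the
    derivative of [f] at [t *: v + x] in direction [v]. *)
Lemma is_derive_line (R : realType) (d : nat) (f : 'rV[R]_d -> R) g (x v : 'rV[R]_d) (t : R) :
  is_gradient f g ->
  is_derive t 1 (fun s : R => f (s *: v + x)) (dotv (g (t *: v + x)) v).
Proof.
move=> /(_ (t *: v + x)) [df dfE].
have E : (fun h : R => h^-1 *: (f ((h *: 1 + t) *: v + x) - f (t *: v + x))) =
         (fun h : R => h^-1 *: ((f \o shift (t *: v + x)) (h *: v) - f (t *: v + x))).
  apply/funext => h /=; congr (_ *: (f _ - _)).
  by rewrite scalerDl addrA (_ : h *: 1 = h :> R)// /GRing.scale/= mulr1.
have dv : derivable f (t *: v + x) v by exact: diff_derivable.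
split; first by move: dv; rewrite /derivable -E.
by rewrite -dfE -deriveE// /derive -E.
Qed.

Lemma descent (R : realType) (d : nat) (L : R) (f : 'rV[R]_d -> R) g x y :
  0 < L -> is_gradient f g -> lipschitz_euc L g ->
  f y <= f x + dotv (g x) (y - x) + L / 2 * sqn (y - x).
Proof.
move=> L0 fg gL; set v := y - x.
(* [phi] is [f] along the segment minus the quadratic bound without its constant term [f x]; a
   nonpositive derivative on the open unit interval gives [phi 1 <= phi 0], which is the claim. *)
pose phi := fun t : R => f (t *: v + x) - (dotv (g x) v * t + L / 2 * sqn v * t ^+ 2).
have dphi (t : R) : is_derive t 1 phi
    (dotv (g (t *: v + x)) v - (dotv (g x) v + L / 2 * sqn v * (2 * t))).
  have df := @is_derive_line _ _ f g x v t fg.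
  apply: is_derive_eq.
  by rewrite /GRing.scale /=; ring.
have : phi 1 <= phi 0.
  apply: (@ler0_derive1_le_cc _ phi 0 1) => //; rewrite ?in_itv/= ?lexx ?ler01//.
  - move=> t; rewrite in_itv/= => /andP[t0 _].
    have dp := dphi t; rewrite derive1E derive_val.
    suff : dotv (g (t *: v + x) - g x) v <= L * t * sqn v by rewrite dotvBl; lra.
    apply: dotv_le_sqn; first exact: mulr_gt0.
    by have := lipschitz_sqn (t *: v + x) x gL; rewrite addrK sqnZ mulrA exprMn.
  - apply: continuous_subspaceT => t.
    by apply: differentiable_continuous; apply/derivable1_diffP; apply: ex_derive.
rewrite /phi scale1r scale0r add0r /v subrK; lra.
Qed.

(* Divide the convexity inequality on the segment from x to y by the parameter and let it tend
   to 0. *)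
Lemma strongly_convex_above_tangent (R : realType) (d : nat) (mu : R) (f : 'rV[R]_d -> R) g x y :
  strongly_convex_euc mu f -> is_gradient f g ->
  f x + dotv (g x) (y - x) + mu / 2 * sqn (y - x) <= f y.
Proof.
move=> fc fg; set v := y - x.
have [df dE] := @is_derive_line _ _ f g x v 0 fg.
rewrite scale0r add0r in dE.
suff : dotv (g x) v <= f y - f x - mu / 2 * sqn v by lra.
apply/ler_addgt0Pr => e e0.
(* The added 1 makes [K] positive; for [h <= e / K] the second-order error [h * (mu / 2 * sqn v)] is
   at most [e]. *)
pose K := `|mu / 2 * sqn v| + 1.
have K0 : 0 < K by rewrite ltr_pwDr.
pose q h : R := h^-1 *: (f ((h *: (1 : R) + 0) *: v + x) - f (0 *: v + x)).
have qD : q h @[h --> 0^'] --> dotv (g x) v by rewrite -dE; exact: df.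
(* Only the limit from the right is usable: the convexity inequality needs a parameter in [0, 1]. *)
have qR := @cvg_dnbhs_at_right R R q 0 _ qD.
apply: (cvgr_to_le qR).
near=> h; have h0 : 0 < h by near: h; exact: nbhs_right_gt.
have h1 : h <= 1 by near: h; exact: nbhs_right_le.
have he : h <= e / K by near: h; apply: nbhs_right_le; exact: divr_gt0.
have hK : h * (mu / 2 * sqn v) <= e.
  rewrite (le_trans (ler_norm _))// normrM gtr0_norm//.
  rewrite ler_pdivlMr// in he; apply: le_trans he.
  by rewrite ler_pM2l// lerDl.
rewrite /q scale0r add0r addr0 [h *: 1]mulr1 [leLHS]mulrC ler_pdivrMr//.
have h01 : 0 <= h <= 1 by rewrite ltW.
have -> : h *: v + x = h *: y + (1 - h) *: x.
  by rewrite /v scalerBr scalerBl scale1r addrAC addrA.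
have := fc y x h h01; rewrite -/v.
have : h * (h * (mu / 2 * sqn v)) <= h * e by rewrite ler_pM2l.
by set S := sqn v; lra.
Unshelve. all: by end_near. Qed.

(** Baillon-Haddad argument: the tangent at [a] from below and the quadratic at [b] from above are
    compared at the trial point b - s (G b - G a), and the two inequalities obtained by exchanging
    the points are added. The case [D = 0] is included because [L = mu] is allowed. *)
Lemma cocoercive (R : realType) (d : nat) (D : R) (h : 'rV[R]_d -> R)
    (G : 'rV[R]_d -> 'rV[R]_d) x y :
  0 <= D ->
  (forall x y, h x + dotv (G x) (y - x) <= h y) ->
  (forall x y, h y <= h x + dotv (G x) (y - x) + D / 2 * sqn (y - x)) ->
  sqn (G x - G y) <= D * dotv (G x - G y) (x - y).
Proof.
move=> D0 low upp.
have half s a b : (s - D / 2 * s ^+ 2) * sqn (G b - G a) <= h b - h a - dotv (G a) (b - a).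
  have := le_trans (low a (b - s *: (G b - G a))) (upp b (b - s *: (G b - G a))).
  have -> : b - s *: (G b - G a) - b = - s *: (G b - G a) by rewrite addrC addKr scaleNr.
  have -> : b - s *: (G b - G a) - a = (b - a) - s *: (G b - G a) by rewrite addrAC.
  rewrite sqnZ dotvZr.
  have -> : dotv (G b) (G b - G a) = sqn (G b - G a) + dotv (G a) (G b - G a).
    by rewrite -[in LHS](subrK (G a) (G b)) dotvDl subrK.
  rewrite (dotvBr (b - a)) dotvZr sqrrN; set S := sqn _; set T := dotv (G a) (G b - G a).
  by lra.
have both s : (2 * s - D * s ^+ 2) * sqn (G x - G y) <= dotv (G x - G y) (x - y).
  have := half s x y; have := half s y x.
  have -> : sqn (G y - G x) = sqn (G x - G y) by rewrite -opprB sqnN.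
  rewrite -(opprB x y) dotvNr dotvBl; lra.
have S0 := sqn_ge0 (G x - G y).
move: D0; rewrite le_eqVlt => /predU1P[D0|D0].
  rewrite -D0 mul0r leNgt; apply/negP => S.
  (* For [D = 0] the bound is linear in [s]; this value makes its left side exceed the right side by
     1. *)
  have := both ((dotv (G x - G y) (x - y) + 1) / sqn (G x - G y) / 2).
  by rewrite -D0 mul0r subr0 [2 * _]mulrC divfK ?pnatr_eq0// divfK ?gt_eqF//; lra.
(* The value [D^-1] maximizes [2 * s - D * s ^+ 2]. *)
have := both D^-1.
rewrite (_ : 2 / D - D * D^-1 ^+ 2 = D^-1); last by field; rewrite gt_eqF.
by rewrite -(ler_pM2l D0) mulrA divff ?gt_eqF// mul1r.
Qed.

(** Subtracting mu/2 |.|^2 leaves a convex [h] whose gradient [G] is cocoercive with constant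
    [L - mu]. With S = |x - y|^2 and a = <G x - G y, x - y>, the squared distance after the step is
    at most (1 - gamma mu)^2 S - gamma (2 - gamma (mu + L)) a, which is affine in a on
    [0, (L - mu) S]; the two endpoints give the two squares in the maximum. *)
Lemma gradient_step_contraction (R : realType) (d : nat) (mu L gamma : R)
    (f : 'rV[R]_d -> R) (g : 'rV[R]_d -> 'rV[R]_d) x y :
  0 < mu -> mu <= L -> 0 < gamma ->
  strongly_convex_euc mu f -> is_gradient f g -> lipschitz_euc L g ->
  sqn ((x - gamma *: g x) - (y - gamma *: g y)) <=
  Num.max ((1 - gamma * mu) ^+ 2) ((gamma * L - 1) ^+ 2) * sqn (x - y).
Proof.
move=> mu0 muL g0 fc fg gL.
have L0 : 0 < L := lt_le_trans mu0 muL.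
have D0 : 0 <= L - mu by rewrite subr_ge0.
pose h z := f z - mu / 2 * sqn z; pose G z := g z - mu *: z.
have hexp (a b : 'rV[R]_d) : sqn b = sqn a + 2 * dotv a (b - a) + sqn (b - a).
  rewrite -sqnD. by congr sqn; rewrite addrC subrK.
have low a b : h a + dotv (G a) (b - a) <= h b.
  have := strongly_convex_above_tangent a b fc fg.
  by rewrite /h /G dotvBl dotvZl (hexp a b); lra.
have upp a b : h b <= h a + dotv (G a) (b - a) + (L - mu) / 2 * sqn (b - a).
  have := descent a b L0 fg gL.
  by rewrite /h /G dotvBl dotvZl (hexp a b); lra.
have co := cocoercive x y D0 low upp.
have gx : dotv (g x - g y) (x - y) <= L * sqn (x - y).
  by apply: dotv_le_sqn => //; exact: lipschitz_sqn.
have GE : G x - G y = (g x - g y) - mu *: (x - y).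
  by apply/rowP => k; rewrite !mxE; ring.
have le : dotv (G x - G y) (x - y) <= (L - mu) * sqn (x - y).
  by rewrite GE dotvBl dotvZl /sqn; rewrite -/(sqn _); lra.
have -> : (x - gamma *: g x) - (y - gamma *: g y) =
    (1 - gamma * mu) *: (x - y) - gamma *: (G x - G y).
  by rewrite GE; apply/rowP => k; rewrite !mxE; ring.
rewrite [X in X <= _]sqnB !sqnZ dotvZl dotvZr (dotvC (x - y)).
set S := sqn (x - y) in gx le *; set a := dotv (G x - G y) (x - y) in co le *.
have S0 : 0 <= S := sqn_ge0 _.
have a0 : 0 <= a.
  (* For [L = mu] one cannot divide by [L - mu]; adding the tangent inequalities at [x] and [y]
     gives the sign of [a]. *)
  have := sqn_ge0 (G x - G y); move: D0; rewrite le_eqVlt => /predU1P[D0|D0].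
    have := low x y; have := low y x.
    rewrite -(opprB y x) dotvNr => h1 h2 _.
    by rewrite /a dotvBl -(opprB y x) !dotvNr; lra.
  by move=> s0; rewrite -(pmulr_rge0 _ D0); exact: le_trans co.
have gco : gamma ^+ 2 * sqn (G x - G y) <= gamma ^+ 2 * ((L - mu) * a).
  by rewrite ler_wpM2l// sqr_ge0.
have [le2|gt2] := leP (gamma * (mu + L)) 2.
  apply: (@le_trans _ _ ((1 - gamma * mu) ^+ 2 * S)).
    have : 0 <= gamma * a * (2 - gamma * (mu + L)).
      by rewrite !mulr_ge0 ?subr_ge0// ltW.
    by move: gco; set T := sqn (G x - G y); nra.
  by rewrite ler_wpM2r// le_max lexx.
apply: (@le_trans _ _ ((gamma * L - 1) ^+ 2 * S)); last first.
  by rewrite ler_wpM2r// le_max lexx orbT.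
have : 0 <= gamma * (gamma * (mu + L) - 2) * ((L - mu) * S - a).
  by rewrite !mulr_ge0 ?subr_ge0// ltW.
by move: gco; set T := sqn (G x - G y); nra.
Qed.

Lemma sum_gradient_minimizer (R : realType) (n d : nat) (L : R)
    (f : 'I_n -> 'rV[R]_d -> R) (g : 'I_n -> 'rV[R]_d -> 'rV[R]_d) xs :
  (0 < n)%N -> 0 < L ->
  (forall i, is_gradient (f i) (g i)) -> (forall i, lipschitz_euc L (g i)) ->
  (forall x, \sum_(i < n) f i xs <= \sum_(i < n) f i x) ->
  \sum_(i < n) g i xs = 0.
Proof.
move=> n0 L0 fg gL xmin; set G := \sum_(i < n) _.
have nL : 0 < n%:R * L by rewrite mulr_gt0// ltr0n.
(* This step minimizes the summed descent bound -s |G|^2 + n L s^2 |G|^2 / 2, leaving -s/2 |G|^2;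
   minimality of [xs] forces this to be nonnegative. *)
pose s := (n%:R * L)^-1.
have := xmin (xs - s *: G).
have : \sum_(i < n) f i (xs - s *: G) <=
    \sum_(i < n) (f i xs + dotv (g i xs) (- (s *: G)) + L / 2 * sqn (- (s *: G))).
  apply: ler_sum => i _; have := descent xs (xs - s *: G) L0 (fg i) (gL i).
  by rewrite (addrC xs) addrK.
move=> h1 h2; have := le_trans h2 h1.
rewrite !big_split /= -dotv_suml -/G dotvNr dotvZr sqnN sqnZ sumr_const card_ord.
rewrite -[_ *+ n]mulr_natl -/(sqn G) => h3.
apply: sqn_eq0.
have e : n%:R * (L / 2 * (s ^+ 2 * sqn G)) = s / 2 * sqn G.
  by rewrite /s; field; rewrite ?gt_eqF// ltr0n n0.
have s0 : 0 < s by rewrite invr_gt0.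
rewrite -(pmulr_rle0 _ s0); lra.
Qed.

(** * One step of the algorithm *)

Definition rp_centered (R : realType) (n d : nat) (grad : 'I_n -> 'rV[R]_d -> 'rV[R]_d)
    (gamma : R) (s : rp_state R n d) (i : 'I_n) : 'rV[R]_d :=
  rp_xhat grad gamma s i - n%:R^-1 *: \sum_(k < n) rp_xhat grad gamma s k.

(* The [V_i] of the expansion of [Psi]. *)
Definition rp_covector (R : realType) (n d : nat) (grad : 'I_n -> 'rV[R]_d -> 'rV[R]_d)
    (gamma om : R) (xs : 'rV[R]_d) (s : rp_state R n d) (i : 'I_n) : 'rV[R]_d :=
  2 *: (s.2 i - (- grad i xs))
  - (2 / (gamma * (1 + om))) *: (rp_xhat grad gamma s i - xs)
  + (4 / (gamma * (1 + om) ^+ 2)) *: rp_centered grad gamma s i.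

Lemma sum_rp_centered (R : realType) (n d : nat) (grad : 'I_n -> 'rV[R]_d -> 'rV[R]_d)
    (gamma : R) (s : rp_state R n d) :
  (0 < n)%N -> \sum_i rp_centered grad gamma s i = 0.
Proof.
move=> n0; rewrite sumrB sumr_const card_ord -scaler_nat scalerA divff ?scale1r ?subrr//.
by rewrite pnatr_eq0 -lt0n.
Qed.

(** Linearity and the sharing of one operator by all i enter here: averaging commutes with [M], so
    an image minus the mean image is the image of the centered vector. *)
Lemma rp_stepE (R : realType) (n d : nat) (grad : 'I_n -> 'rV[R]_d -> 'rV[R]_d)
    (gamma om : R) (M : 'M[R]_d) (s : rp_state R n d) :
  rp_step grad gamma om M s =
  (fun i => rp_xhat grad gamma s i - (1 + om)^-1 *: (rp_centered grad gamma s i *m M),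
   fun i => s.2 i + (gamma * (1 + om) ^+ 2)^-1 *: (rp_centered grad gamma s i *m M)).
Proof.
have E i : rp_centered grad gamma s i *m M = rp_xhat grad gamma s i *m M -
    n%:R^-1 *: \sum_(k < n) (rp_xhat grad gamma s k *m M).
  by rewrite /rp_centered mulmxBl -scalemxAl mulmx_suml.
by rewrite /rp_step /=; congr pair; apply/funext => i; rewrite E.
Qed.

Lemma sum_rp_step2 (R : realType) (n d : nat) (grad : 'I_n -> 'rV[R]_d -> 'rV[R]_d)
    (gamma om : R) (M : 'M[R]_d) (s : rp_state R n d) :
  (0 < n)%N -> \sum_i (rp_step grad gamma om M s).2 i = \sum_i s.2 i.
Proof.
move=> n0; rewrite rp_stepE /= big_split /= -scaler_sumr -mulmx_suml.
by rewrite sum_rp_centered// mul0mx scaler0 addr0.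
Qed.

(** An identity for arbitrary vectors, with [e] in the role of d_i. The second and third summands
    vanish only after summation over i; the coefficient 4 comes from |e|^2 = |e - z|^2 + 2 <z, e -
    z> + |z|^2. *)
Lemma step_expansion (R : realType) (d : nat) (gamma q : R) (p b z e : 'rV[R]_d) :
  gamma != 0 -> q != 0 ->
  gamma^-1 * sqn (p - q^-1 *: e) + gamma * q ^+ 2 * sqn (b + (gamma * q ^+ 2)^-1 *: e) =
  (gamma^-1 * sqn (p + gamma *: b) + gamma * (q ^+ 2 - 1) * sqn b)
  + 2 * (dotv b z - dotv b p)
  + 2 / (gamma * q) * (sqn z - dotv p z)
  + 2 / (gamma * q ^+ 2) * (sqn (e - z) - (q - 1) * sqn z)
  + dotv (2 *: b - (2 / (gamma * q)) *: p + (4 / (gamma * q ^+ 2)) *: z) (e - z).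
Proof.
move=> g0 q0; rewrite /sqn !dotvE.
rewrite (dotvC e p) (dotvC e b) (dotvC e z) (dotvC b p).
by field; rewrite g0 q0.
Qed.

Lemma rp_Psi_step_le (R : realType) (n d : nat) (grad : 'I_n -> 'rV[R]_d -> 'rV[R]_d)
    (gamma om m : R) (xs : 'rV[R]_d) (M : 'M[R]_d) (s : rp_state R n d) :
  (0 < n)%N -> 0 < gamma -> 0 <= om ->
  \sum_i s.2 i = 0 -> \sum_i grad i xs = 0 ->
  (forall i x y, sqn ((x - gamma *: grad i x) - (y - gamma *: grad i y)) <= m * sqn (x - y)) ->
  rp_Psi grad gamma om xs (rp_step grad gamma om M s) <=
  Num.max m (1 - ((1 + om) ^+ 2)^-1) * rp_Psi grad gamma om xs s
  + 2 / (gamma * (1 + om) ^+ 2) * \sum_i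
     (sqn (rp_centered grad gamma s i *m M - rp_centered grad gamma s i)
      - om * sqn (rp_centered grad gamma s i))
  + \sum_i dotv (rp_covector grad gamma om xs s i)
                (rp_centered grad gamma s i *m M - rp_centered grad gamma s i).
Proof.
move=> n0 g0 om0 su sg ctr.
have q0 : 0 < 1 + om by rewrite ltr_pwDl.
set q := 1 + om in q0 *; set c := Num.max _ _.
pose p i := rp_xhat grad gamma s i - xs.
pose b i := s.2 i - (- grad i xs).
pose z i := rp_centered grad gamma s i.
pose dd i := z i *m M.
pose w i := (s.1 i - gamma *: grad i (s.1 i)) - (xs - gamma *: grad i xs).
(* Every [p i - z i] equals this one vector, which drops out of inner products summed against a
   family of zero sum such as [z] or [b]. *)
pose mn := n%:R^-1 *: (\sum_(k < n) rp_xhat grad gamma s k) - xs.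
have zp i : p i = z i + mn by rewrite /p /z /mn /rp_centered addrA subrK.
have sz : \sum_i z i = 0 by exact: sum_rp_centered.
have sb : \sum_i b i = 0 by rewrite sumrB su sumrN sg oppr0 subrr.
have wE i : w i = p i + gamma *: b i.
  by apply/rowP => k; rewrite /w /p /b /rp_xhat !mxE; ring.
have pz : \sum_i dotv (p i) (z i) = \sum_i sqn (z i).
  under eq_bigr do rewrite zp dotvDl (dotvC mn).
  by rewrite big_split /= -dotv_suml sz dot0v addr0.
have bz : \sum_i dotv (b i) (z i) = \sum_i dotv (b i) (p i).
  under [in RHS]eq_bigr do rewrite zp dotvDr.
  by rewrite big_split /= -dotv_suml sb dot0v addr0.
have qE : q - 1 = om by rewrite /q addrC addKr.
have termE i :
    gamma^-1 * sqn (p i - q^-1 *: dd i) + gamma * q ^+ 2 * sqn (b i + (gamma * q ^+ 2)^-1 *: dd i) =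
    (gamma^-1 * sqn (w i) + gamma * (q ^+ 2 - 1) * sqn (b i))
    + 2 * (dotv (b i) (z i) - dotv (b i) (p i))
    + 2 / (gamma * q) * (sqn (z i) - dotv (p i) (z i))
    + 2 / (gamma * q ^+ 2) * (sqn (dd i - z i) - om * sqn (z i))
    + dotv (rp_covector grad gamma om xs s i) (dd i - z i).
  by rewrite wE (step_expansion (p i) (b i) (z i) (dd i)) ?gt_eqF// qE.
rewrite rp_stepE /rp_Psi /= -/q.
have -> : \sum_(i < n)
     (gamma^-1 * sqn (rp_xhat grad gamma s i - q^-1 *: (rp_centered grad gamma s i *m M) - xs) +
      gamma * q ^+ 2 * sqn (s.2 i + (gamma * q ^+ 2)^-1 *: (rp_centered grad gamma s i *m M)
         - - grad i xs)) =
   \sum_(i < n) (gamma^-1 * sqn (w i) + gamma * (q ^+ 2 - 1) * sqn (b i))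
   + 2 / (gamma * q ^+ 2) * \sum_i (sqn (dd i - z i) - om * sqn (z i))
   + \sum_i dotv (rp_covector grad gamma om xs s i) (dd i - z i).
  transitivity (\sum_i (gamma^-1 * sqn (p i - q^-1 *: dd i) +
       gamma * q ^+ 2 * sqn (b i + (gamma * q ^+ 2)^-1 *: dd i))).
    by apply: eq_bigr => i _; rewrite -addrAC [s.2 i + _ - _]addrAC.
  under eq_bigr do rewrite termE.
  have bz0 : \sum_i (dotv (b i) (z i) - dotv (b i) (p i)) = 0 by rewrite sumrB bz subrr.
  have pz0 : \sum_i (sqn (z i) - dotv (p i) (z i)) = 0 by rewrite sumrB pz subrr.
  by rewrite big_split big_split big_split big_split /= -!mulr_sumr bz0 pz0 !mulr0 !addr0.
rewrite lerD2r lerD2r mulr_sumr; apply: ler_sum => i _.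
rewrite [leRHS]mulrDr; apply: lerD.
  rewrite mulrCA ler_pM2l ?invr_gt0//; apply: le_trans (ctr i _ _) _.
  by rewrite ler_wpM2r ?sqn_ge0// le_max lexx.
rewrite -/(b i) mulrA ler_wpM2r ?sqn_ge0//.
have -> : gamma * (q ^+ 2 - 1) = (1 - (q ^+ 2)^-1) * (gamma * q ^+ 2).
  by field; rewrite gt_eqF.
rewrite ler_wpM2r ?mulr_ge0 ?exprn_ge0 ?(ltW q0) ?(ltW g0)//.
by rewrite le_max lexx orbT.
Qed.

(** * Measurability *)

Lemma coord_le_enorm (R : realType) (d : nat) (x : 'rV[R]_d) j : `|x ord0 j| <= enorm x.
Proof. by rewrite /enorm -sqrtr_sqr ler_wsqrtr// sqr_coord_le_sqn. Qed.

Lemma enorm_le_sum_norm (R : realType) (d : nat) (x : 'rV[R]_d) :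
  enorm x <= \sum_j `|x ord0 j|.
Proof.
have S0 : 0 <= \sum_j `|x ord0 j| by exact: sumr_ge0.
rewrite -(@ler_pXn2r _ 2) ?nnegrE ?sqrtr_ge0// sqr_sqrtr ?sqn_ge0// expr2 mulr_suml.
apply: ler_sum => j _; rewrite -expr2 -real_normK ?num_real// expr2 ler_wpM2l//.
by rewrite (bigD1 j) //= lerDl sumr_ge0.
Qed.

(** The sum of coordinate distances replaces the norm to match the coordinatewise measurability and
    integrability used for random vectors. *)
Lemma lipschitz_coord (R : realType) (d : nat) (L : R) (g : 'rV[R]_d -> 'rV[R]_d) x y j :
  0 <= L -> lipschitz_euc L g ->
  `|g x ord0 j - g y ord0 j| <= L * \sum_k `|x ord0 k - y ord0 k|.
Proof.
move=> L0 gL; have := coord_le_enorm (g x - g y) j; rewrite !mxE => /le_trans; apply.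
apply: le_trans (gL x y) _; rewrite ler_wpM2l//.
by have := enorm_le_sum_norm (x - y); under eq_bigr do rewrite !mxE.
Qed.

(* McShane: [phi = inf_r (phi r + K * |. - r|_1)] with [r] over the rational points. *)
Lemma measurable_lipschitz_comp (R : realType) (d : nat) (dT : measure_display)
    (T : measurableType dT) (phi : 'rV[R]_d -> R) (K : R) (X : T -> 'rV[R]_d) :
  0 <= K ->
  (forall x y, `|phi x - phi y| <= K * \sum_k `|x ord0 k - y ord0 k|) ->
  (forall j, measurable_fun setT (fun w => X w ord0 j)) ->
  measurable_fun setT (fun w => phi (X w)).
Proof.
move=> K0 phiK mX mT; apply: (measurability _ (RGenInftyO.measurableE R)) => //.
move=> _ [_ [a ->] <-].
pose rv (r : {ffun 'I_d -> rat}) : 'rV[R]_d := \row_k ratr (r k).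
pose h (r : {ffun 'I_d -> rat}) w := phi (rv r) + K * \sum_k `|X w ord0 k - rv r ord0 k|.
have -> : (fun w => phi (X w)) @^-1` `]-oo, a[%classic =
    \bigcup_r (h r @^-1` `]-oo, a[%classic).
  apply/seteqP; split => [w|w [r _]] /=; rewrite !in_itv /=; last first.
    by apply: le_lt_trans; rewrite -lerBlDl (le_trans (ler_norm _)).
  move=> pa.
  (* The approximation error is paid twice, in [phi (rv r)] and in the penalty, each time at most K
     d e; the 1 keeps the denominator positive and the final inequality strict. *)
  pose e := (a - phi (X w)) / (2 * K * d%:R + 1).
  have dn0 : 0 < 2 * K * d%:R + 1 :> R by rewrite ltr_wpDl// !mulr_ge0.
  have e0 : 0 < e by rewrite divr_gt0 ?subr_gt0.
  have /choice[r rP] : forall k : 'I_d, exists q : rat, `|X w ord0 k - ratr q| < e.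
    move=> k; have [|q] := @rat_in_itvoo R (X w ord0 k - e) (X w ord0 k + e).
      by rewrite ltrD2l gt0_cp// ltW.
    by rewrite in_itv/= => /andP[q1 q2]; exists q; rewrite ltr_norml; apply/andP; split; lra.
  exists [ffun k => r k] => //=; rewrite in_itv/= /h.
  set S := \sum_k _.
  have SE : S <= d%:R * e.
    rewrite /S mulr_natl -[X in _ *+ X](card_ord d) -sumr_const.
    by apply: ler_sum => k _; rewrite mxE ffunE ltW.
  have := phiK (rv [ffun k => r k]) (X w).
  under eq_bigr do rewrite distrC.
  rewrite -/S => /(le_trans (ler_norm _)) h1.
  have KS : K * S <= K * (d%:R * e) by rewrite ler_wpM2l.
  have ea : 2 * K * d%:R * e < a - phi (X w).
    by rewrite /e mulrCA gtr_pMr ?subr_gt0// ltr_pdivrMr// mul1r ltrDl.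
  by lra.
rewrite setTI; apply: countable_bigcupT_measurable => // r.
have mh : measurable_fun setT (h r).
  apply: measurable_funD => //; apply: measurable_funM => //.
  apply: measurable_sum => k; apply: measurableT_comp => //.
  by apply: measurable_funB.
by rewrite -[X in measurable X]setTI; apply: mh.
Qed.

(** [T] is arbitrary so that the result serves both the ambient sigma-algebra and the one generated
    by the past; the gradient is measurable because it is Lipschitz. *)
Lemma measurable_rp_xhat (R : realType) (n d : nat) (L : R)
    (grad : 'I_n -> 'rV[R]_d -> 'rV[R]_d) (gamma : R) (dT : measure_display)
    (T : measurableType dT) (s : T -> rp_state R n d) :
  0 <= L -> (forall i, lipschitz_euc L (grad i)) ->
  (forall i j, measurable_fun setT (fun w => (s w).1 i ord0 j)) ->
  (forall i j, measurable_fun setT (fun w => (s w).2 i ord0 j)) ->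
  forall i j, measurable_fun setT (fun w => rp_xhat grad gamma (s w) i ord0 j).
Proof.
move=> L0 gL m1 m2 i j.
under eq_fun do rewrite /rp_xhat !mxE.
apply: measurable_funB; last exact: measurable_funM.
apply: measurable_funB => //; apply: measurable_funM => //.
apply: (@measurable_lipschitz_comp _ _ _ _ (fun x => grad i x ord0 j) L) => //.
by move=> x y; exact: lipschitz_coord.
Qed.

Lemma measurable_rp_centered (R : realType) (n d : nat) (L : R)
    (grad : 'I_n -> 'rV[R]_d -> 'rV[R]_d) (gamma : R) (dT : measure_display)
    (T : measurableType dT) (s : T -> rp_state R n d) :
  0 <= L -> (forall i, lipschitz_euc L (grad i)) ->
  (forall i j, measurable_fun setT (fun w => (s w).1 i ord0 j)) ->
  (forall i j, measurable_fun setT (fun w => (s w).2 i ord0 j)) ->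
  forall i j, measurable_fun setT (fun w => rp_centered grad gamma (s w) i ord0 j).
Proof.
move=> L0 gL m1 m2 i j; have mx := measurable_rp_xhat gamma L0 gL m1 m2.
have E w : rp_centered grad gamma (s w) i ord0 j = rp_xhat grad gamma (s w) i ord0 j
    - n%:R^-1 * \sum_k rp_xhat grad gamma (s w) k ord0 j.
  by rewrite mxE [X in _ + X]mxE [X in _ - X]mxE summxE.
under eq_fun do rewrite E.
apply: measurable_funB => //; apply: measurable_funM => //.
by apply: measurable_sum.
Qed.

Lemma measurable_rp_covector (R : realType) (n d : nat) (L : R)
    (grad : 'I_n -> 'rV[R]_d -> 'rV[R]_d) (gamma om : R) (xs : 'rV[R]_d) (dT : measure_display)
    (T : measurableType dT) (s : T -> rp_state R n d) :
  0 <= L -> (forall i, lipschitz_euc L (grad i)) ->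
  (forall i j, measurable_fun setT (fun w => (s w).1 i ord0 j)) ->
  (forall i j, measurable_fun setT (fun w => (s w).2 i ord0 j)) ->
  forall i j, measurable_fun setT (fun w => rp_covector grad gamma om xs (s w) i ord0 j).
Proof.
move=> L0 gL m1 m2 i j; have mx := measurable_rp_xhat gamma L0 gL m1 m2.
have mz := measurable_rp_centered gamma L0 gL m1 m2.
have E w : rp_covector grad gamma om xs (s w) i ord0 j =
    2 * ((s w).2 i ord0 j - - grad i xs ord0 j)
    - 2 / (gamma * (1 + om)) * (rp_xhat grad gamma (s w) i ord0 j - xs ord0 j)
    + 4 / (gamma * (1 + om) ^+ 2) * rp_centered grad gamma (s w) i ord0 j.
  by rewrite /rp_covector; move: (rp_centered _ _ _ _) (rp_xhat _ _ _ _) => z x; rewrite !mxE.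
under eq_fun do rewrite E.
apply: measurable_funD; last exact: measurable_funM.
by apply: measurable_funB; apply: measurable_funM => //; exact: measurable_funB.
Qed.

Lemma measurable_rp_iter (R : realType) (n d : nat) (L : R)
    (grad : 'I_n -> 'rV[R]_d -> 'rV[R]_d) (gamma om : R) (dT : measure_display)
    (T : measurableType dT) (Rop : nat -> T -> 'M[R]_d) (s0 : rp_state R n d) :
  0 <= L -> (forall i, lipschitz_euc L (grad i)) ->
  (forall t a b, measurable_fun setT (fun w => Rop t w a b)) ->
  forall t i j,
    measurable_fun setT (fun w => (rp_iter grad gamma om (Rop^~ w) s0 t).1 i ord0 j) /\
    measurable_fun setT (fun w => (rp_iter grad gamma om (Rop^~ w) s0 t).2 i ord0 j).
Proof.
move=> L0 gL mR; elim=> [|t IH] i j; first by split; exact: measurable_cst.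
have m1 i' j' := (IH i' j').1; have m2 i' j' := (IH i' j').2.
have md : measurable_fun setT (fun w =>
    (rp_centered grad gamma (rp_iter grad gamma om (Rop^~ w) s0 t) i *m Rop t w) ord0 j).
  under eq_fun do rewrite mxE.
  apply: measurable_sum => k; apply: measurable_funM => //.
  exact: (measurable_rp_centered (L := L)).
have stE w := rp_stepE grad gamma om (Rop t w) (rp_iter grad gamma om (Rop^~ w) s0 t).
split; under eq_fun do rewrite [rp_iter _ _ _ _ _ _]stE.
  under eq_fun do rewrite /= mxE [X in _ + X]mxE [X in _ - X]mxE.
  apply: measurable_funB; last exact: measurable_funM.
  exact: (measurable_rp_xhat (L := L)).
under eq_fun do rewrite /= mxE [X in _ + X]mxE.
by apply: measurable_funD => //; exact: measurable_funM.
Qed.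

(** Translates the measurability used by the oracle into that of a measurable space, where the
    closure properties of measurable functions apply. *)
Lemma meas_wrt_sigmaP (Omega : pointedType) (R : realType) (G : set (set Omega)) (h : Omega -> R) :
  meas_wrt <<s G>> h <-> measurable_fun [set: g_sigma_algebraType G] h.
Proof.
split=> [hG _ B mB|hG B mB]; first by rewrite setTI; exact: hG.
by rewrite -[h @^-1` B]setTI; exact: hG.
Qed.

Lemma meas_wrt_rp_filt (R : realType) (n d : nat) (grad : 'I_n -> 'rV[R]_d -> 'rV[R]_d)
    (gamma om : R) (Omega : Type) (Rop : nat -> Omega -> 'M[R]_d) (s0 : rp_state R n d) t i j :
  meas_wrt (rp_filt grad gamma om Rop s0 t)
    (fun w => (rp_iter grad gamma om (Rop^~ w) s0 t).1 i ord0 j) /\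
  meas_wrt (rp_filt grad gamma om Rop s0 t)
    (fun w => (rp_iter grad gamma om (Rop^~ w) s0 t).2 i ord0 j).
Proof.
split=> B mB; apply: sub_sigma_algebra; exists t, i, j, B; do 2 split=> //; [by left|by right].
Qed.

(** The two kinds of random vector submitted to the oracle: the centered vector for the variance
    bound, its multiples by a covector coordinate for unbiasedness. *)
Lemma meas_wrt_covector_centered (R : realType) (n d : nat) (L : R)
    (grad : 'I_n -> 'rV[R]_d -> 'rV[R]_d) (gamma om : R) (xs : 'rV[R]_d) (Omega : pointedType)
    (Rop : nat -> Omega -> 'M[R]_d) (s0 : rp_state R n d) t i :
  0 <= L -> (forall i, lipschitz_euc L (grad i)) ->
  let st w := rp_iter grad gamma om (Rop^~ w) s0 t in
  forall j,
  meas_wrt (rp_filt grad gamma om Rop s0 t) (fun w => rp_centered grad gamma (st w) i ord0 j) /\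
  forall k, meas_wrt (rp_filt grad gamma om Rop s0 t) (fun w =>
    (rp_covector grad gamma om xs (st w) i ord0 k *: rp_centered grad gamma (st w) i) ord0 j).
Proof.
move=> L0 gL st j; rewrite /rp_filt.
set G := (X in <<s X >>).
have m1 i' j' : measurable_fun [set: g_sigma_algebraType G] (fun w => (st w).1 i' ord0 j').
  by apply/meas_wrt_sigmaP; exact: (meas_wrt_rp_filt grad gamma om Rop s0 t i' j').1.
have m2 i' j' : measurable_fun [set: g_sigma_algebraType G] (fun w => (st w).2 i' ord0 j').
  by apply/meas_wrt_sigmaP; exact: (meas_wrt_rp_filt grad gamma om Rop s0 t i' j').2.
have mz := measurable_rp_centered gamma L0 gL m1 m2.
split=> [|k]; apply/meas_wrt_sigmaP; first exact: mz.
under eq_fun do rewrite mxE.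
apply: measurable_funM; last exact: mz.
exact: (measurable_rp_covector gamma om xs L0 gL m1 m2).
Qed.

(** * Square integrable random variables *)

(** Squares are controlled because the cross term <V_i, d_i - z_i> multiplies two random vectors. *)
Definition sq_integrable (R : realType) (dO : measure_display) (Omega : measurableType dO)
    (P : probability Omega R) (h : Omega -> R) : Prop :=
  measurable_fun setT h /\ P.-integrable setT (fun w => (h w ^+ 2)%:E).

Section SquareIntegrable.
Context (R : realType) (dO : measure_display) (Omega : measurableType dO).
Context (P : probability Omega R).
Implicit Types f g h : Omega -> R.

Lemma integrable_EFinD f g :
  P.-integrable setT (fun w => (f w)%:E) -> P.-integrable setT (fun w => (g w)%:E) ->
  P.-integrable setT (fun w => (f w + g w)%:E).
Proof. by move=> fi gi; under eq_fun do rewrite EFinD; exact: integrableD. Qed.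

Lemma integrable_EFinZ (a : R) f : P.-integrable setT (fun w => (f w)%:E) ->
  P.-integrable setT (fun w => (a * f w)%:E).
Proof. by move=> fi; under eq_fun do rewrite EFinM; exact: integrableZl. Qed.

Lemma integrable_dominated f g : measurable_fun setT f ->
  P.-integrable setT (fun w => (g w)%:E) -> (forall w, `|f w| <= g w) ->
  P.-integrable setT (fun w => (f w)%:E).
Proof.
move=> mf ig fg; apply: (le_integrable measurableT _ _ ig); first exact/measurable_EFinP.
by move=> w _; rewrite /= lee_fin (le_trans (fg w)) ?ler_norm.
Qed.

Lemma sq_integrable_dominated f g : measurable_fun setT f -> sq_integrable P g ->
  (forall w, `|f w| <= `|g w|) -> sq_integrable P f.
Proof.
move=> mf [mg ig] fg; split=> //; apply: integrable_dominated ig _ => [|w].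
  exact: measurable_funX.
rewrite ger0_norm ?sqr_ge0// -(real_normK (num_real (f w))) -(real_normK (num_real (g w))).
by rewrite lerXn2r ?nnegrE.
Qed.

Lemma sq_integrableD f g : sq_integrable P f -> sq_integrable P g ->
  sq_integrable P (fun w => f w + g w).
Proof.
move=> [mf if2] [mg ig2]; split; first exact: measurable_funD.
have is2 := integrable_EFinD if2 ig2.
have i2 := integrable_EFinD is2 is2.
apply: (@integrable_dominated _ (fun w => (f w ^+ 2 + g w ^+ 2) + (f w ^+ 2 + g w ^+ 2))) => //.
  by apply: measurable_funX; exact: measurable_funD.
move=> w; rewrite ger0_norm ?sqr_ge0//.
by have := sqr_ge0 (f w - g w); lra.
Qed.

Lemma sq_integrableM_integrable f g : sq_integrable P f -> sq_integrable P g ->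
  P.-integrable setT (fun w => (f w * g w)%:E).
Proof.
move=> [mf if2] [mg ig2].
apply: (@integrable_dominated _ (fun w => f w ^+ 2 + g w ^+ 2)).
- exact: measurable_funM.
- exact: integrable_EFinD.
move=> w; have := sqr_ge0 (f w - g w); have := sqr_ge0 (f w + g w).
by rewrite ler_norml => h1 h2; apply/andP; split; nra.
Qed.

Lemma sq_integrable_cst (a : R) : sq_integrable P (fun=> a).
Proof.
by split; [exact: measurable_cst|exact: finite_measure_integrable_cst].
Qed.

Lemma sq_integrableZ (a : R) f : sq_integrable P f -> sq_integrable P (fun w => a * f w).
Proof.
move=> [mf if2]; split; first exact: measurable_funM.
by under eq_fun do rewrite exprMn; exact: integrable_EFinZ.
Qed.

Lemma sq_integrableB f g : sq_integrable P f -> sq_integrable P g ->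
  sq_integrable P (fun w => f w - g w).
Proof.
move=> lf lg; have := sq_integrableD lf (sq_integrableZ (-1) lg).
by under eq_fun do rewrite mulN1r.
Qed.

Lemma sq_integrable_norm f : sq_integrable P f -> sq_integrable P (fun w => `|f w|).
Proof.
move=> lf; apply: (sq_integrable_dominated _ lf) => [|w]; last by rewrite normr_id.
by apply: measurableT_comp => //; case: lf.
Qed.

Lemma sq_integrable_sum (I : Type) (r : seq I) (F : I -> Omega -> R) :
  (forall i, sq_integrable P (F i)) -> sq_integrable P (fun w => \sum_(i <- r) F i w).
Proof.
move=> lF; elim: r => [|i r IH].
  by under eq_fun do rewrite big_nil; exact: sq_integrable_cst.
by under eq_fun do rewrite big_cons; exact: sq_integrableD.
Qed.

Lemma integrable_EFin_sum (I : Type) (r : seq I) (F : I -> Omega -> R) :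
  (forall i, P.-integrable setT (fun w => (F i w)%:E)) ->
  P.-integrable setT (fun w => (\sum_(i <- r) F i w)%:E).
Proof.
move=> iF; under eq_fun do rewrite -sumEFin; exact: integrable_sum.
Qed.

Lemma Rintegral_sum (I : Type) (r : seq I) (F : I -> Omega -> R) :
  (forall i, P.-integrable setT (fun w => (F i w)%:E)) ->
  \int[P]_w (\sum_(i <- r) F i w) = \sum_(i <- r) \int[P]_w F i w.
Proof.
move=> iF; elim: r => [|i r IH].
  by under eq_Rintegral do rewrite big_nil; rewrite big_nil Rintegral_cst// mul0r.
under eq_Rintegral do rewrite big_cons.
rewrite big_cons -IH RintegralD//; first exact: iF.
exact: (integrable_EFin_sum r iF).
Qed.

Lemma integrable_dotv (d : nat) (X Y : Omega -> 'rV[R]_d) :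
  (forall j, sq_integrable P (fun w => X w ord0 j)) ->
  (forall j, sq_integrable P (fun w => Y w ord0 j)) ->
  P.-integrable setT (fun w => (dotv (X w) (Y w))%:E).
Proof. by move=> lX lY; apply: integrable_EFin_sum => j; exact: sq_integrableM_integrable. Qed.

End SquareIntegrable.

Lemma coordB (R : realType) (d : nat) (x y : 'rV[R]_d) j :
  (x - y) ord0 j = x ord0 j - y ord0 j.
Proof. by rewrite !mxE. Qed.

Lemma EFin_Rintegral (R : realType) (dO : measure_display) (Omega : measurableType dO)
    (P : probability Omega R) (h : Omega -> R) :
  P.-integrable setT (fun w => (h w)%:E) -> (\int[P]_w (h w)%:E)%E = (\int[P]_w h w)%:E.
Proof. by move=> ih; rewrite /Rintegral fineK//; exact: integrable_fin_num. Qed.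

(** * Expectation of the Lyapunov function *)

Section Expectation.
Context (R : realType) (n d : nat) (grad : 'I_n -> 'rV[R]_d -> 'rV[R]_d) (L gamma om : R).
Context (dO : measure_display) (Omega : measurableType dO) (P : probability Omega R).
Context (Rop : nat -> Omega -> 'M[R]_d) (s0 : rp_state R n d).
Hypothesis L0 : 0 <= L.
Hypothesis gL : forall i, lipschitz_euc L (grad i).
Hypothesis mR : forall t a b, measurable_fun setT (fun w => Rop t w a b).
Hypothesis orc : rp_oracle grad gamma om P Rop s0.

Let st t w := rp_iter grad gamma om (Rop^~ w) s0 t.
Let z t i w := rp_centered grad gamma (st t w) i.

Lemma sq_integrable_rp_xhat (s : Omega -> rp_state R n d) :
  (forall i j, sq_integrable P (fun w => (s w).1 i ord0 j)) ->
  (forall i j, sq_integrable P (fun w => (s w).2 i ord0 j)) ->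
  forall i j, sq_integrable P (fun w => rp_xhat grad gamma (s w) i ord0 j).
Proof.
move=> l1 l2 i j; under eq_fun do rewrite /rp_xhat !mxE.
apply: sq_integrableB; last exact: sq_integrableZ.
apply: sq_integrableB => //; apply: sq_integrableZ.
(* Linear growth of a Lipschitz gradient, measured from the origin. *)
pose B w := `|grad i 0 ord0 j| + L * \sum_k `|(s w).1 i ord0 k|.
apply: (@sq_integrable_dominated _ _ _ _ _ B) => [||w].
- apply: (@measurable_lipschitz_comp _ _ _ _ (fun x => grad i x ord0 j) L) => //.
    by move=> x y; exact: lipschitz_coord.
  by move=> k; case: (l1 i k).
- apply: sq_integrableD; first exact: sq_integrable_cst.
  apply: sq_integrableZ; apply: sq_integrable_sum => k; exact: sq_integrable_norm.
rewrite [leRHS]ger0_norm; last by rewrite addr_ge0// mulr_ge0// sumr_ge0.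
have := lipschitz_coord ((s w).1 i) 0 j L0 (gL i).
under eq_bigr do rewrite mxE subr0.
by move=> h; rewrite -lerBlDl (le_trans _ h)// lerB_dist.
Qed.

Lemma sq_integrable_rp_centered (s : Omega -> rp_state R n d) :
  (forall i j, sq_integrable P (fun w => (s w).1 i ord0 j)) ->
  (forall i j, sq_integrable P (fun w => (s w).2 i ord0 j)) ->
  forall i j, sq_integrable P (fun w => rp_centered grad gamma (s w) i ord0 j).
Proof.
move=> l1 l2 i j; have lx := sq_integrable_rp_xhat l1 l2.
have E w : rp_centered grad gamma (s w) i ord0 j = rp_xhat grad gamma (s w) i ord0 j
    - n%:R^-1 * \sum_k rp_xhat grad gamma (s w) k ord0 j.
  by rewrite mxE [X in _ + X]mxE [X in _ - X]mxE summxE.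
under eq_fun do rewrite E.
apply: sq_integrableB => //; apply: sq_integrableZ; exact: sq_integrable_sum.
Qed.

Lemma sq_integrable_rp_covector (xs : 'rV[R]_d) (s : Omega -> rp_state R n d) :
  (forall i j, sq_integrable P (fun w => (s w).1 i ord0 j)) ->
  (forall i j, sq_integrable P (fun w => (s w).2 i ord0 j)) ->
  forall i j, sq_integrable P (fun w => rp_covector grad gamma om xs (s w) i ord0 j).
Proof.
move=> l1 l2 i j; have lx := sq_integrable_rp_xhat l1 l2.
have lz := sq_integrable_rp_centered l1 l2.
have E w : rp_covector grad gamma om xs (s w) i ord0 j =
    2 * ((s w).2 i ord0 j - - grad i xs ord0 j)
    - 2 / (gamma * (1 + om)) * (rp_xhat grad gamma (s w) i ord0 j - xs ord0 j)
    + 4 / (gamma * (1 + om) ^+ 2) * rp_centered grad gamma (s w) i ord0 j.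
  by rewrite /rp_covector; move: (rp_centered _ _ _ _) (rp_xhat _ _ _ _) => y x; rewrite !mxE.
under eq_fun do rewrite E.
apply: sq_integrableD; last exact: sq_integrableZ.
by apply: sq_integrableB; apply: sq_integrableZ; apply: sq_integrableB => //;
  exact: sq_integrable_cst.
Qed.

Lemma rp_filtT t : rp_filt grad gamma om Rop s0 t setT.
Proof. exact: (@measurableT _ (g_sigma_algebraType _)). Qed.

Lemma measurable_centeredM t i j : measurable_fun setT (fun w => (z t i w *m Rop t w) ord0 j).
Proof.
under eq_fun do rewrite mxE.
apply: measurable_sum => k; apply: measurable_funM => //.
by apply: (measurable_rp_centered (L := L)) => // i' j';
  have [] := measurable_rp_iter gamma om s0 L0 gL mR t i' j'.
Qed.

Lemma sq_integrable_noise t :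
  (forall i j, sq_integrable P (fun w => (st t w).1 i ord0 j)) ->
  (forall i j, sq_integrable P (fun w => (st t w).2 i ord0 j)) ->
  forall i j, sq_integrable P (fun w => (z t i w *m Rop t w - z t i w) ord0 j).
Proof.
move=> l1 l2 i j; have lz := sq_integrable_rp_centered l1 l2.
have mN k : measurable_fun setT (fun w => (z t i w *m Rop t w - z t i w) ord0 k).
  under eq_fun do rewrite coordB.
  apply: measurable_funB; first exact: measurable_centeredM.
  by case: (lz i k).
split=> //.
have iN : P.-integrable setT (fun w => (sqn (z t i w *m Rop t w - z t i w))%:E).
  apply/integrableP; split.
    by apply/measurable_EFinP; apply: measurable_sum => k; exact: measurable_funM.
  (* The event is the whole space; the [0] below fills the argument [xs], on which the centered
     vector does not depend. *)
  have [_ /(_ setT (@rp_filtT t))] := @orc t (z t i)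
    (fun k => (meas_wrt_covector_centered gamma om 0 Rop s0 t i L0 gL k).1).
  have -> : (\int[P]_w `|(sqn (z t i w *m Rop t w - z t i w))%:E| =
      \int[P]_w (sqn (z t i w *m Rop t w - z t i w))%:E)%E.
    by apply: eq_integral => w _; rewrite gee0_abs// lee_fin sqn_ge0.
  move=> /le_lt_trans; apply.
  have iz : P.-integrable setT (fun w => (om * sqn (z t i w))%:E).
    by apply: integrable_EFinZ; apply: integrable_dotv => k; exact: lz.
  by rewrite EFin_Rintegral// ltry.
apply: integrable_dominated iN _ => [|w]; first exact: measurable_funX.
by rewrite ger0_norm ?sqr_ge0// sqr_coord_le_sqn.
Qed.

Lemma sq_integrable_rp_iter t i j :
  sq_integrable P (fun w => (st t w).1 i ord0 j) /\
  sq_integrable P (fun w => (st t w).2 i ord0 j).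
Proof.
elim: t i j => [|t IH] i j; first by split; exact: sq_integrable_cst.
have l1 i' j' := (IH i' j').1; have l2 i' j' := (IH i' j').2.
(* No moment bound on the entries of [Rop] is assumed, so d_i is recovered as noise plus z_i. *)
have ld : sq_integrable P (fun w => (z t i w *m Rop t w) ord0 j).
  have := sq_integrableD (sq_integrable_noise l1 l2 i j) (sq_integrable_rp_centered l1 l2 i j).
  by under eq_fun do rewrite coordB subrK.
have stE w : st t.+1 w = _ := rp_stepE grad gamma om (Rop t w) (st t w).
split; under eq_fun do rewrite stE /= mxE [X in _ + X]mxE ?[X in _ - X]mxE.
  by apply: sq_integrableB; [exact: sq_integrable_rp_xhat|exact: sq_integrableZ].
by apply: sq_integrableD => //; exact: sq_integrableZ.
Qed.

Let l1 t i j := (sq_integrable_rp_iter t i j).1.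
Let l2 t i j := (sq_integrable_rp_iter t i j).2.

Lemma noise_variance t i :
  \int[P]_w sqn (z t i w *m Rop t w - z t i w) <= om * \int[P]_w sqn (z t i w).
Proof.
have lz := sq_integrable_rp_centered (l1 t) (l2 t).
have iz : P.-integrable setT (fun w => (sqn (z t i w))%:E).
  by apply: integrable_dotv => j; exact: lz.
have lN := sq_integrable_noise (l1 t) (l2 t).
have iN : P.-integrable setT (fun w => (sqn (z t i w *m Rop t w - z t i w))%:E).
  by apply: integrable_dotv => j; exact: lN.
rewrite -RintegralZl// -lee_fin -!EFin_Rintegral//; last exact: integrable_EFinZ.
by have [_ /(_ setT (@rp_filtT t))] := @orc t (z t i)
    (fun k => (meas_wrt_covector_centered gamma om 0 Rop s0 t i L0 gL k).1).
Qed.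

(* The oracle is applied to [v_k *: z], one coordinate [v_k] of the covector at a time: this is
   again measurable for the past, and its image under the operator is [v_k *: (z *m M)]. *)
Lemma noise_unbiased t i xs :
  \int[P]_w dotv (rp_covector grad gamma om xs (st t w) i) (z t i w *m Rop t w - z t i w) = 0.
Proof.
have lz := sq_integrable_rp_centered (l1 t) (l2 t).
have lV := sq_integrable_rp_covector xs (l1 t) (l2 t).
have lN := sq_integrable_noise (l1 t) (l2 t).
have ld k : sq_integrable P (fun w => (z t i w *m Rop t w) ord0 k).
  have := sq_integrableD (lN i k) (lz i k).
  by under eq_fun do rewrite coordB subrK.
rewrite Rintegral_sum => [|k]; last exact: sq_integrableM_integrable.
rewrite big1// => k _.
set V := fun w => rp_covector grad gamma om xs (st t w) i ord0 k.
(* These discharge the integrability premises of the oracle for [V *: z] and for its image. *)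
have iVd j := sq_integrableM_integrable (lV i k) (ld j).
have iVz j := sq_integrableM_integrable (lV i k) (lz i j).
have VdE w j : ((V w *: z t i w) *m Rop t w) ord0 j = V w * (z t i w *m Rop t w) ord0 j.
  by rewrite -scalemxAl mxE.
have VzE w j : (V w *: z t i w) ord0 j = V w * z t i w ord0 j by rewrite mxE.
have [+ _] := @orc t (fun w => V w *: z t i w)
    (fun j => (meas_wrt_covector_centered gamma om xs Rop s0 t i L0 gL j).2 k).
move=> /(_ _ _ setT (@rp_filtT t) k) H.
have {}H : \int[P]_w (V w * (z t i w *m Rop t w) ord0 k) = \int[P]_w (V w * z t i w ord0 k).
  apply: EFin_inj; rewrite -!EFin_Rintegral//.
  under eq_integral do rewrite -VdE; under [RHS]eq_integral do rewrite -VzE.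
  by apply: H => j; [under eq_fun do rewrite VzE|under eq_fun do rewrite VdE].
under eq_Rintegral do rewrite coordB mulrBr.
rewrite RintegralB//; [by apply/eqP; rewrite subr_eq0; exact/eqP|exact: iVd|exact: iVz].
Qed.

Lemma integrable_rp_Psi t xs :
  P.-integrable setT (fun w => (rp_Psi grad gamma om xs (st t w))%:E).
Proof.
apply: integrable_EFin_sum => i; apply: integrable_EFinD; apply: integrable_EFinZ.
  have l j : sq_integrable P (fun w => ((st t w).1 i - xs) ord0 j).
    by under eq_fun do rewrite coordB; apply: sq_integrableB; [exact: l1|exact: sq_integrable_cst].
  exact: (integrable_dotv l l).
have l j : sq_integrable P (fun w => ((st t w).2 i - - grad i xs) ord0 j).
  by under eq_fun do rewrite coordB; apply: sq_integrableB; [exact: l2|exact: sq_integrable_cst].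
exact: (integrable_dotv l l).
Qed.

Lemma Rintegral_rp_Psi_step t (xs : 'rV[R]_d) (m : R) :
  (0 < n)%N -> 0 < gamma -> 0 <= om ->
  \sum_i s0.2 i = 0 -> \sum_i grad i xs = 0 ->
  (forall i x y, sqn ((x - gamma *: grad i x) - (y - gamma *: grad i y)) <= m * sqn (x - y)) ->
  \int[P]_w rp_Psi grad gamma om xs (st t.+1 w) <=
  Num.max m (1 - ((1 + om) ^+ 2)^-1) * \int[P]_w rp_Psi grad gamma om xs (st t w).
Proof.
move=> n0 g0 om0 su sg ctr; set c := Num.max _ _.
have lz := sq_integrable_rp_centered (l1 t) (l2 t).
have lV := sq_integrable_rp_covector xs (l1 t) (l2 t).
have lN := sq_integrable_noise (l1 t) (l2 t).
have sut w : \sum_i (st t w).2 i = 0.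
  elim: (t) => [|t' IH]//; rewrite -[RHS]IH; exact: sum_rp_step2.
pose k := 2 / (gamma * (1 + om) ^+ 2).
pose A i w := sqn (z t i w *m Rop t w - z t i w) - om * sqn (z t i w).
pose B i w := dotv (rp_covector grad gamma om xs (st t w) i) (z t i w *m Rop t w - z t i w).
have iN i : P.-integrable setT (fun w => (sqn (z t i w *m Rop t w - z t i w))%:E).
  by apply: integrable_dotv => j; exact: lN.
have iz i : P.-integrable setT (fun w => (sqn (z t i w))%:E).
  by apply: integrable_dotv => j; exact: lz.
have iA i : P.-integrable setT (fun w => (A i w)%:E).
  rewrite /A; under eq_fun do rewrite -mulNr.
  by apply: integrable_EFinD => //; exact: integrable_EFinZ.
have iB i : P.-integrable setT (fun w => (B i w)%:E).
  by apply: integrable_dotv => j; [exact: lV|exact: lN].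
have iP := integrable_rp_Psi t xs.
have icP := integrable_EFinZ c iP.
have ikA := integrable_EFinZ k (integrable_EFin_sum (index_enum 'I_n) iA).
have iSB := integrable_EFin_sum (index_enum 'I_n) iB.
have icA := integrable_EFinD icP ikA.
apply: (@le_trans _ _ (\int[P]_w (c * rp_Psi grad gamma om xs (st t w)
    + k * \sum_i A i w + \sum_i B i w))).
  apply: le_Rintegral => //; [exact: integrable_rp_Psi|exact: integrable_EFinD|].
  by move=> w _; exact: (rp_Psi_step_le _ n0 g0 om0 (sut w) sg ctr).
have SB : \int[P]_w (\sum_i B i w) = 0.
  by rewrite Rintegral_sum// big1// => i _; exact: noise_unbiased.
have SA : \int[P]_w (\sum_i A i w) <= 0.
  rewrite Rintegral_sum//; apply: sumr_le0 => i _.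
  rewrite /A (RintegralB measurableT (iN i) (integrable_EFinZ om (iz i))).
  rewrite (RintegralZl _ measurableT (iz i)) subr_le0; exact: noise_variance.
rewrite RintegralD// SB addr0 RintegralD// RintegralZl// RintegralZl//; last first.
  exact: (integrable_EFin_sum _ iA).
rewrite -[leRHS]addr0 lerD2l mulr_ge0_le0//.
by rewrite divr_ge0// mulr_ge0 ?ltW// exprn_gt0// ltr_pwDl.
Qed.

End Expectation.

(** * Almost sure convergence *)

(* The series of the [h t] is integrable, hence finite almost everywhere. *)
Lemma ae_cvg0_geometric (R : realType) (dO : measure_display) (Omega : measurableType dO)
    (P : probability Omega R) (h : nat -> Omega -> R) (c C : R) :
  0 <= c -> c < 1 -> 0 <= C -> (forall t w, 0 <= h t w) ->
  (forall t, P.-integrable setT (fun w => (h t w)%:E)) ->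
  (forall t, \int[P]_w h t w <= c ^+ t * C) ->
  {ae P, forall w, h ^~ w @ \oo --> (0 : R)}.
Proof.
move=> c0 c1 C0 h0 ih hle.
have mh t : measurable_fun setT (fun w => (h t w)%:E) by case/integrableP: (ih t).
have h0E t w : (0 <= (h t w)%:E)%E by rewrite lee_fin.
pose g w := (\sum_(t <oo) (h t w)%:E)%E.
have ig : P.-integrable setT g.
  apply/integrableP; split.
    by apply: ge0_emeasurable_sum => [t w _ _|t _]; [exact: h0E|exact: mh].
  have -> : (\int[P]_w `|g w| = \int[P]_w g w)%E.
    by apply: eq_integral => w _; rewrite gee0_abs// /g; exact: nneseries_ge0.
  rewrite integral_nneseries//.
  apply: (@le_lt_trans _ _ (C / (1 - c))%:E); last exact: ltry.
  apply: lime_le.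
    by apply: is_cvg_nneseries => t _ _; exact: integral_ge0.
  near=> k.
  under eq_bigr do rewrite EFin_Rintegral//.
  rewrite sumEFin lee_fin.
  apply: (@le_trans _ _ (series (geometric C c) k)).
    by rewrite /series /=; apply: ler_sum => t _; rewrite mulrC; exact: hle.
  rewrite geometric_seriesE ?lt_eqF//= ler_wpM2r ?invr_ge0 ?subr_ge0 ?(ltW c1)//.
  by rewrite ler_piMr// gerBl exprn_ge0.
have := integrable_ae measurableT ig.
apply: filterS => w /(_ I) gfin.
(* The finite value [g w] bounds the nondecreasing partial sums, so the series converges and its
   terms tend to 0. *)
apply: cvg_series_cvg_0; apply: nondecreasing_is_cvgn.
  by apply: nondecreasing_series => t _ _; exact: h0.
exists (fine (g w)) => _ [k _ <-].
rewrite -lee_fin fineK// /series /= -sumEFin.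
by apply: nneseries_lim_ge => t _ _; exact: h0E.
Unshelve. all: by end_near. Qed.

(** Row vectors converge in the maximum norm, and the square of each coordinate is at most [sqn]. *)
Lemma cvg_rV_sqn (R : realType) (d : nat) (v : nat -> 'rV[R]_d) (l : 'rV[R]_d)
    (a : nat -> R) (K : R) :
  (forall t, sqn (v t - l) <= K * a t) -> a @ \oo --> (0 : R) -> v @ \oo --> l.
Proof.
move=> va a0; apply/cvgrPdistC_lt => e e0.
have Ka : (fun t => K * a t) @ \oo --> (0 : R).
  by rewrite -(mulr0 K); apply: cvgM => //; exact: cvg_cst.
have : \forall t \near \oo, K * a t < e ^+ 2.
  by apply: (cvgr_lt 0) => //; exact: exprn_gt0.
apply: filterS => t hK.
rewrite /Num.norm /= mx_normrE; apply: bigmax_lt => // -[i j] _ /=; rewrite (ord1 i).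
rewrite -(@ltr_pXn2r _ 2) ?nnegrE ?(ltW e0)// real_normK ?num_real//.
exact: le_lt_trans (sqr_coord_le_sqn _ j) (le_lt_trans (va t) hK).
Qed.

Lemma rp_Psi_term_le (R : realType) (n d : nat) (grad : 'I_n -> 'rV[R]_d -> 'rV[R]_d)
    (gamma om : R) (xs : 'rV[R]_d) (s : rp_state R n d) i :
  0 < gamma -> 0 <= om ->
  gamma^-1 * sqn (s.1 i - xs) <= rp_Psi grad gamma om xs s /\
  gamma * (1 + om) ^+ 2 * sqn (s.2 i - - grad i xs) <= rp_Psi grad gamma om xs s.
Proof.
move=> g0 om0.
have t1 k : 0 <= gamma^-1 * sqn (s.1 k - xs) by rewrite mulr_ge0 ?sqn_ge0// invr_ge0 ltW.
have t2 k : 0 <= gamma * (1 + om) ^+ 2 * sqn (s.2 k - - grad k xs).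
  by rewrite mulr_ge0 ?sqn_ge0// mulr_ge0 ?sqr_ge0// ltW.
suff : gamma^-1 * sqn (s.1 i - xs) + gamma * (1 + om) ^+ 2 * sqn (s.2 i - - grad i xs)
    <= rp_Psi grad gamma om xs s.
  by move: (t1 i) (t2 i); lra.
rewrite /rp_Psi [leRHS](bigD1 i)//= lerDl.
by apply: sumr_ge0 => k _; exact: addr_ge0.
Qed.

Lemma rp_Psi_ge0 (R : realType) (n d : nat) (grad : 'I_n -> 'rV[R]_d -> 'rV[R]_d)
    (gamma om : R) (xs : 'rV[R]_d) (s : rp_state R n d) :
  0 < gamma -> 0 <= rp_Psi grad gamma om xs s.
Proof.
move=> g0; apply: sumr_ge0 => i _; rewrite addr_ge0//; apply: mulr_ge0; rewrite ?sqn_ge0//.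
  by rewrite invr_ge0 ltW.
by rewrite mulr_ge0 ?sqr_ge0// ltW.
Qed.

Lemma rp_Psi_cvg0 (R : realType) (n d : nat) (grad : 'I_n -> 'rV[R]_d -> 'rV[R]_d)
    (gamma om m : R) (xs : 'rV[R]_d) (s : nat -> rp_state R n d) :
  0 < gamma -> 0 <= om -> 0 <= m ->
  (forall i x y, sqn ((x - gamma *: grad i x) - (y - gamma *: grad i y)) <= m * sqn (x - y)) ->
  (fun t => rp_Psi grad gamma om xs (s t)) @ \oo --> (0 : R) ->
  forall i, (fun t => (s t).1 i) @ \oo --> xs /\
    (fun t => rp_xhat grad gamma (s t) i) @ \oo --> xs /\
    (fun t => (s t).2 i) @ \oo --> - grad i xs.
Proof.
move=> g0 om0 m0 ctr P0 i.
have k0 : 0 < gamma * (1 + om) ^+ 2 by rewrite mulr_gt0// exprn_gt0// ltr_pwDl.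
have bx t : sqn ((s t).1 i - xs) <= gamma * rp_Psi grad gamma om xs (s t).
  by rewrite -ler_pdivrMl//; case: (rp_Psi_term_le grad xs (s t) i g0 om0).
have bu t : sqn ((s t).2 i - - grad i xs) <=
    (gamma * (1 + om) ^+ 2)^-1 * rp_Psi grad gamma om xs (s t).
  by rewrite ler_pdivlMl//; case: (rp_Psi_term_le grad xs (s t) i g0 om0).
split; [|split].
- exact: cvg_rV_sqn bx P0.
- apply: (@cvg_rV_sqn _ _ _ _ _
    (2 * (m * gamma) + 2 * (gamma ^+ 2 * (gamma * (1 + om) ^+ 2)^-1)) _ P0) => t.
  (* Psi does not contain xhat_i; its error is a difference of two gradient steps minus gamma times
     the error of u_i, and Psi controls both. *)
  have -> : rp_xhat grad gamma (s t) i - xs =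
      (((s t).1 i - gamma *: grad i ((s t).1 i)) - (xs - gamma *: grad i xs))
      - gamma *: ((s t).2 i - - grad i xs).
    by apply/rowP => j; rewrite /rp_xhat !mxE; ring.
  rewrite (le_trans (sqnB_le _ _))// [leRHS]mulrDl; apply: lerD; rewrite -[leRHS]mulrA ler_pM2l//.
    by rewrite (le_trans (ctr i _ _))// -mulrA ler_wpM2l.
  by rewrite sqnZ -mulrA ler_wpM2l// sqr_ge0.
- exact: cvg_rV_sqn bu P0.
Qed.

Theorem theorem10 (R : realType) (n d : nat)
    (f : 'I_n -> 'rV[R]_d -> R) (grad : 'I_n -> 'rV[R]_d -> 'rV[R]_d)
    (mu L gamma om : R)
    (dO : measure_display) (Omega : measurableType dO) (P : probability Omega R)
    (Rop : nat -> Omega -> 'M[R]_d) (x0 u0 : 'I_n -> 'rV[R]_d)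
    (xstar : 'rV[R]_d) :
  (0 < n)%N -> (0 < d)%N -> 0 < mu -> mu <= L ->
  (forall i, strongly_convex_euc mu (f i)) ->
  (forall i, is_gradient (f i) (grad i)) ->
  (forall i, lipschitz_euc L (grad i)) ->
  \sum_(i < n) u0 i = 0 ->
  0 < gamma -> gamma < 2 / L -> 0 <= om ->
  (forall t a b, measurable_fun setT (fun w => Rop t w a b)) ->
  rp_oracle grad gamma om P Rop (x0, u0) ->
  (forall x, \sum_(i < n) f i xstar <= \sum_(i < n) f i x) ->
  let st := fun t w => rp_iter grad gamma om (Rop^~ w) (x0, u0) t in
  let c := Num.max (Num.max ((1 - gamma * mu) ^+ 2) ((gamma * L - 1) ^+ 2))
                   (1 - ((1 + om) ^+ 2)^-1) in
  c < 1 /\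
  (forall t : nat,
     (\int[P]_w (rp_Psi grad gamma om xstar (st t w))%:E <=
      (c ^+ t * rp_Psi grad gamma om xstar (x0, u0))%:E)%E) /\
  {ae P, forall w, forall i : 'I_n,
     (fun t => (st t w).1 i) @ \oo --> xstar /\
     (fun t => rp_xhat grad gamma (st t w) i) @ \oo --> xstar /\
     (fun t => (st t w).2 i) @ \oo --> - grad i xstar}.
Proof.
move=> n0 _ mu0 muL fc fg gL su g0 g2 om0 mR orc xmin st c.
have L0 : 0 < L := lt_le_trans mu0 muL.
have gL2 : gamma * L < 2 by rewrite -ltr_pdivlMr.
have gmu : 0 < gamma * mu by rewrite mulr_gt0.
have gmuL : gamma * mu <= gamma * L by rewrite ler_pM2l.
have c1 : c < 1.
  rewrite !gt_max; apply/andP; split; last first.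
    by rewrite gtrBl invr_gt0 exprn_gt0// ltr_pwDl.
  (* 1 - (1 - a)^2 = a (2 - a) is positive for a = gamma mu and a = gamma L, both in (0, 2). *)
  by apply/andP; split; rewrite -subr_gt0; [
    rewrite (_ : 1 - _ = gamma * mu * (2 - gamma * mu)); last by ring
   |rewrite (_ : 1 - _ = gamma * L * (2 - gamma * L)); last by ring];
    rewrite mulr_gt0// ?subr_gt0//; lra.
have c0 : 0 <= c by rewrite !le_max sqr_ge0.
have sg := sum_gradient_minimizer n0 L0 fg gL xmin.
have ctr i x y := gradient_step_contraction x y mu0 muL g0 (fc i) (fg i) (gL i).
have step t := @Rintegral_rp_Psi_step _ _ _ _ _ _ _ _ _ P Rop (x0, u0) (ltW L0) gL mR orc
  t xstar _ n0 g0 om0 su sg ctr.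
have iPsi t := integrable_rp_Psi (ltW L0) gL mR orc t xstar.
have EPsi t : \int[P]_w rp_Psi grad gamma om xstar (st t w) <=
    c ^+ t * rp_Psi grad gamma om xstar (x0, u0).
  elim: t => [|t IH]; last first.
    apply: le_trans (step t) _; rewrite -/c exprS -[leRHS]mulrA.
    exact: ler_wpM2l.
  (* At t = 0 the state is constant, and total mass 1 makes the integral equal to its value. *)
  have /(congr1 fine) PT : P setT = 1%E by exact: probability_setT.
  by rewrite /st /= Rintegral_cst// [fine _]PT mulr1 expr0 mul1r.
split=> //; split=> [t|].
  by rewrite (EFin_Rintegral (iPsi t)) lee_fin; exact: EPsi.
have := ae_cvg0_geometric c0 c1 (rp_Psi_ge0 grad om xstar (x0, u0) g0)
  (fun t w => rp_Psi_ge0 grad om xstar (st t w) g0) iPsi EPsi.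
apply: filterS => w P0 i.
apply: (rp_Psi_cvg0 g0 om0 _ ctr P0).
by rewrite le_max sqr_ge0.
Qed.
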